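(* Fix an imprecise probabilities tree with finite state space $\mathscr{X}$, and let $\overline{\mathrm{E}}_{\mathrm V}$ be the corresponding game-theoretic upper expectation. For any $f\colon\Omega\to\overline{\mathbb{R}}$ and any situation $s\in\mathscr{X}^{\ast}$, \[\overline{\mathrm{E}}_{\mathrm V}(f\vert s)=\inf\{\mathscr{M}(s):\mathscr{M}\in\overline{\mathbb{M}}_{\mathrm b}\text{ and }\lim\mathscr{M}\ge_s f\},\] where the condition $\lim\mathscr{M}\ge_s f$ means that, for every $\omega\in\Gamma(s)$, the limit $\lim_{n\to+\infty}\mathscr{M}(\omega^n)$ exists in $\overline{\mathbb{R}}$ and is at least $f(\omega)$.
   Context: Notation: $\mathbb{N}=\{1,2,\dots\}$, $\mathbb{N}_0=\mathbb{N}\cup\{0\}$, $\overline{\mathbb{R}}=\mathbb{R}\cup\{-\infty,+\infty\}$, with conventions $+\infty-\infty=-\infty+\infty=+\infty$, $0\cdot(\pm\infty)=0$, $\inf\emptyset=+\infty$. For a non-empty set $\mathscr{Y}$, $\overline{\mathscr{L}}(\mathscr{Y})$ is the set of all maps $\mathscr{Y}\to\overline{\mathbb{R}}$ and $\overline{\mathscr{L}}_b(\mathscr{Y})$ the subset of those bounded below by a real constant. Limits and inequalities of functions are pointwise. Local models: $\mathscr{X}$ is a finite non-empty set. $\mathscr{X}^{\ast}=\bigcup_{n\in\mathbb{N}_0}\mathscr{X}^n$ is the set of situations (finite strings, including the empty string $\Box$). An imprecise probabilities tree assigns to each $s\in\mathscr{X}^{\ast}$ a map $\overline{\mathrm{Q}}_s\colon\overline{\mathscr{L}}(\mathscr{X})\to\overline{\mathbb{R}}$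 that is an upper expectation, i.e. satisfies: (E1) $\overline{\mathrm{Q}}_s(c)=c$ for all $c\in\mathbb{R}$; (E2) $\overline{\mathrm{Q}}_s(f+g)\le\overline{\mathrm{Q}}_s(f)+\overline{\mathrm{Q}}_s(g)$ for all $f,g\in\overline{\mathscr{L}}_b(\mathscr{X})$; (E3) $\overline{\mathrm{Q}}_s(\lambda f)=\lambda\overline{\mathrm{Q}}_s(f)$ for all real $\lambda>0$ and $f\in\overline{\mathscr{L}}_b(\mathscr{X})$; (E4) $f\le g\Rightarrow\overline{\mathrm{Q}}_s(f)\le\overline{\mathrm{Q}}_s(g)$ for all $f,g\in\overline{\mathscr{L}}_b(\mathscr{X})$; (E5) $\lim_n\overline{\mathrm{Q}}_s(f_n)=\overline{\mathrm{Q}}_s(\lim_n f_n)$ for every non-decreasing sequence $\{f_n\}_{n\in\mathbb{N}_0}$ of non-negative variables in $\overline{\mathscr{L}}_b(\mathscr{X})$. Global model: $\Omega=\mathscr{X}^{\mathbb{N}}$ is the set of paths; for $\omega\in\Omega$, $\omega^n\in\mathscr{X}^n$ is the string of its first $n$ values; $\Gamma(x_{1:n})=\{\omega\in\Omega:\omega^n=x_{1:n}\}$. For $g,h\colon\Omega\to\overline{\mathbb{R}}$, $g\ge_s h$ means $g(\omega)\ge h(\omega)$ for all $\omega\in\Gamma(s)$. A supermartingale is a map $\mathscr{M}\colon\mathscr{X}^{\ast}\to\overline{\mathbb{R}}$ with $\overline{\mathrm{Q}}_s(\mathscr{M}(s\,\cdot))\le\mathscr{M}(s)$ for all $s\in\mathscr{X}^{\ast}$,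 where $\mathscr{M}(s\,\cdot)\in\overline{\mathscr{L}}(\mathscr{X})$ is $x\mapsto\mathscr{M}(sx)$. $\overline{\mathbb{M}}_{\mathrm b}$ is the set of supermartingales bounded below by a real constant, and $\liminf\mathscr{M}(\omega)=\liminf_{n\to+\infty}\mathscr{M}(\omega^n)$. The game-theoretic upper expectation is, for all $f\colon\Omega\to\overline{\mathbb{R}}$ and $s\in\mathscr{X}^{\ast}$, \[\overline{\mathrm{E}}_{\mathrm V}(f\vert s)=\inf\{\mathscr{M}(s):\mathscr{M}\in\overline{\mathbb{M}}_{\mathrm b},\ \liminf\mathscr{M}\ge_s f\}.\] *)

(* Defs.v *)
From HB Require Import structures.
From mathcomp Require Export all_boot all_order all_algebra.
From mathcomp Require Export all_classical all_reals all_analysis.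

Set Implicit Arguments.
Unset Strict Implicit.
Unset Printing Implicit Defensive.

Import Order.TTheory GRing.Theory Num.Theory.
Import numFieldNormedType.Exports.

Local Open Scope classical_set_scope.
Local Open Scope ring_scope.
Local Open Scope ereal_scope.

Definition bounded_below (R : realType) (Y : Type) (g : Y -> \bar R) : Prop :=
  exists c : R, forall y, c%:E <= g y.

(** In [UE_subadditive], [dual_adde] is the addition of [\bar R] for which
    +oo + -oo = -oo + +oo = +oo; the default addition yields -oo instead.
    In [UE_cvg], nonnegativity already makes every [f n] bounded below. *)
Record upper_expectation (R : realType) (X : finType)
    (Q : (X -> \bar R) -> \bar R) : Prop := UpperExpectation {
  UE_cst : forall c : R, Q (fun=> c%:E) = c%:E ;
  UE_subadditive : forall f g : X -> \bar R,
    bounded_below f -> bounded_below g ->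
    Q (fun x => dual_adde (f x) (g x)) <= dual_adde (Q f) (Q g) ;
  UE_homogeneous : forall (lambda : R) (f : X -> \bar R),
    (0 < lambda)%R -> bounded_below f ->
    Q (fun x => lambda%:E * f x) = lambda%:E * Q f ;
  UE_monotone : forall f g : X -> \bar R,
    bounded_below f -> bounded_below g ->
    (forall x, f x <= g x) -> Q f <= Q g ;
  UE_cvg : forall f : nat -> X -> \bar R,
    (forall n x, 0 <= f n x) ->
    (forall x, nondecreasing_seq (fun n => f n x)) ->
    (fun n => Q (f n)) @ \oo --> Q (fun x => limn (fun n => f n x)) }.

(** Situations are finite strings [s : seq X], the empty one being [[::]]. *)
Definition imprecise_tree (R : realType) (X : finType)
    (Q : seq X -> (X -> \bar R) -> \bar R) : Prop :=
  forall s, upper_expectation (Q s).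

(** A path is a function [w : nat -> X]; indexing starts at 0, so that
    [w 0], ..., [w n.-1] are its first [n] values. *)
Definition path_take (X : Type) (w : nat -> X) (n : nat) : seq X := mkseq w n.

Definition cylinder (X : Type) (s : seq X) : set (nat -> X) :=
  [set w | path_take w (size s) = s].

Definition supermartingale (R : realType) (X : finType)
    (Q : seq X -> (X -> \bar R) -> \bar R) (M : seq X -> \bar R) : Prop :=
  forall s, Q s (fun x => M (rcons s x)) <= M s.

Definition bb_supermartingale (R : realType) (X : finType)
    (Q : seq X -> (X -> \bar R) -> \bar R) : set (seq X -> \bar R) :=
  [set M | supermartingale Q M /\ bounded_below M].

Definition liminf_ge_on (R : realType) (X : finType) (s : seq X)
    (M : seq X -> \bar R) (f : (nat -> X) -> \bar R) : Prop :=
  forall w, cylinder s w -> f w <= limn_einf (fun n => M (path_take w n)).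

(** [cvgn] at type [\bar R] is existence of a limit in the extended reals,
    infinite limits included. *)
Definition lim_ge_on (R : realType) (X : finType) (s : seq X)
    (M : seq X -> \bar R) (f : (nat -> X) -> \bar R) : Prop :=
  forall w, cylinder s w ->
    cvgn (fun n => M (path_take w n)) /\
    f w <= limn (fun n => M (path_take w n)).

Definition upper_EV (R : realType) (X : finType)
    (Q : seq X -> (X -> \bar R) -> \bar R)
    (f : (nat -> X) -> \bar R) (s : seq X) : \bar R :=
  ereal_inf [set M s | M in [set M | bb_supermartingale Q M /\
                                     liminf_ge_on s M f]].

(* Main.v *)
(** Given a supermartingale [M] bounded below by [c <= 0] whose lower limit
    dominates [f], put [v = M - c + 1 >= 1] and trade [v] with stake
    [1 / a ^ 2], where the anchor [a] is a past value of [v] that is updated as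
    soon as [v] has moved away from it by at least [d].  As [1 / a ^ 2] is the slope at [a]
    of the concave function [- 1 / x], the accumulated wealth is, up to a
    constant, the sum of the tangent to [- 1 / x] at [a], evaluated at [v],
    which is bounded, and of a nondecreasing process that jumps by the gap
    between the tangent and the curve at each update of [a].  If [v] keeps
    oscillating by more than [2 d] without tending to +oo, these jumps add up
    to +oo.  Mixing the meshes [d = 1 / (k + 1)] with weights [2 ^ - (k + 1)]
    yields a process [hedge >= - 1] that tends to +oo whenever [v] neither
    converges nor tends to +oo, and that has a finite or infinite limit when [v]
    converges.  Hence [M + e * (1 + hedge)] is a supermartingale above [M] that
    converges on every path and starts at [M s + e]. *)

Require Import Defs.
From mathcomp Require Import ring lra.

Set Implicit Arguments.
Unset Strict Implicit.
Unset Printing Implicit Defensive.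

Import Order.TTheory GRing.Theory Num.Theory.
Import numFieldNormedType.Exports.

Local Open Scope classical_set_scope.
Local Open Scope ring_scope.

(** * Trading a single mesh: anchors, tangents and realized gains *)

Section Rebalancing.
Variable R : realType.
Implicit Types (v : nat -> R) (d a x : R).

(** The tangent to [- 1 / x] at [a]. *)
Definition tangent a x : R := x / a ^+ 2 - 2 / a.

(** [tangent a x + 1 / x] *)
Definition tangent_gap a x : R := (x - a) ^+ 2 / (a ^+ 2 * x).

Fixpoint anchor d v (n : nat) : R :=
  if n is n'.+1 then
    let a := anchor d v n' in if d <= `|v n - a| then v n else a
  else v 0.

Fixpoint wealth d v (n : nat) : R :=
  if n is n'.+1 then wealth d v n' + (v n - v n') / anchor d v n' ^+ 2 else 0.

Definition realized d v n : R := wealth d v n - tangent (anchor d v n) (v n).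

Lemma anchor_ge1 d v n : (forall i, 1 <= v i) -> 1 <= anchor d v n.
Proof. by move=> v1; elim: n => //= n IHn; case: ifP. Qed.

Lemma anchor_close d v n : 0 < d -> `|v n - anchor d v n| < d.
Proof.
move=> d0; elim: n => /= [|n IHn]; first by rewrite subrr normr0.
by case: ifPn; rewrite ?subrr ?normr0 // -ltNge.
Qed.

(** Multiplied by [a ^+ 2], this is [(x - 1) + (a - 1) ^+ 2 >= 0]. *)
Lemma tangent_ge a x : 1 <= a -> 1 <= x -> - 1 <= tangent a x.
Proof.
move=> a1 x1; rewrite /tangent.
have a0 : 0 < a by lra.
have -> : x / a ^+ 2 - 2 / a = (x - 2 * a) / a ^+ 2 by field; lra.
rewrite ler_pdivlMr ?exprn_gt0//; nra.
Qed.

Lemma tangent_le0 a x : 1 <= a -> `|x - a| < 1 -> tangent a x <= 0.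
Proof.
move=> a1 xa; rewrite /tangent.
have a0 : 0 < a by lra.
have -> : x / a ^+ 2 - 2 / a = (x - 2 * a) / a ^+ 2 by field; lra.
rewrite ler_pdivrMr ?exprn_gt0// mul0r.
by move: xa; rewrite ltr_norml => /andP[_]; lra.
Qed.

Lemma tangent_gap_ge0 a x : 1 <= x -> 0 <= tangent_gap a x.
Proof.
move=> x1; apply: divr_ge0; first exact: sqr_ge0.
by apply: mulr_ge0; [exact: sqr_ge0 | lra].
Qed.

(** Only the anchor has to be bounded: the gap grows linearly for large [x], so [v] may jump
    arbitrarily far up. *)
Lemma tangent_gap_ge d a x (B : R) : 0 < d <= 1 -> 1 <= a <= B -> 1 <= x ->
  d <= `|x - a| -> d ^+ 2 / (B ^+ 2 * (B + 1)) <= tangent_gap a x.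
Proof.
move=> /andP[d0 d1] /andP[a1 aB] x1 dxa.
have a0 : 0 < a by lra.
have B0 : 0 < B by lra.
have x0 : 0 < x by lra.
rewrite /tangent_gap ler_pdivrMr ?mulr_gt0 ?exprn_gt0//; last lra.
rewrite mulrAC ler_pdivlMr ?mulr_gt0 ?exprn_gt0//.
have d2 : d ^+ 2 <= (x - a) ^+ 2.
  by rewrite -(real_normK (num_real (x - a))) ler_sqr ?nnegrE; lra.
have a2 : a ^+ 2 <= B ^+ 2 by rewrite ler_sqr ?nnegrE; lra.
have dx : d ^+ 2 * x <= (x - a) ^+ 2 * (B + 1).
  have [xa|xa] := leP x a.
    by apply: ler_pM => //; rewrite ?sqr_ge0//; lra.
  (* Split [x] into [x - a], where [d ^+ 2 <= d <= x - a], and [a <= B]. *)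
  have xad : d <= x - a by move: dxa; rewrite gtr0_norm; lra.
  have d2y : d ^+ 2 * (x - a) <= (x - a) ^+ 2.
    rewrite !expr2 ler_wpM2r//; first lra.
    by apply: le_trans xad; rewrite ler_piMr; lra.
  have d2a : d ^+ 2 * a <= (x - a) ^+ 2 * B.
    by apply: ler_pM => //; [exact: sqr_ge0 | lra].
  by move: d2y d2a; rewrite mulrBr (mulrDr _ B) mulr1; lra.
have -> : d ^+ 2 * (a ^+ 2 * x) = a ^+ 2 * (d ^+ 2 * x) by ring.
rewrite [leRHS](_ : _ = B ^+ 2 * ((x - a) ^+ 2 * (B + 1))); last by ring.
apply: ler_pM => //; first exact: sqr_ge0.
by apply: mulr_ge0; [exact: sqr_ge0 | lra].
Qed.

(** Between updates the stake is the slope of the tangent, so wealth and tangent move together; at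
    an update the tangent value drops to [- 1 / v n.+1], which releases the gap. *)
Lemma realizedS d v n : (forall i, 1 <= v i) ->
  realized d v n.+1 = realized d v n +
    (if d <= `|v n.+1 - anchor d v n|
     then tangent_gap (anchor d v n) (v n.+1) else 0).
Proof.
move=> v1; rewrite /realized /= /tangent /tangent_gap.
have a1 := anchor_ge1 d n v1; have x1 := v1 n.+1.
set a := anchor d v n in a1 *.
by case: ifP => _; field; rewrite ?andbT; lra.
Qed.

Lemma realized_nondecreasing d v : (forall i, 1 <= v i) ->
  nondecreasing_seq (realized d v).
Proof.
move=> v1; apply/nondecreasing_seqP => n; rewrite realizedS// lerDl.
by case: ifP => // _; apply: tangent_gap_ge0.
Qed.

(** No look-ahead: this lets the hedge of a situation be reused along its extensions. *)
Lemma anchor_ext d v v' n : (forall i, (i <= n)%N -> v i = v' i) ->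
  anchor d v n = anchor d v' n.
Proof.
elim: n => /= [->//|n IHn vv']; rewrite IHn ?vv'// => i ilen.
by apply: vv'; exact: leqW.
Qed.

Lemma wealth_ext d v v' n : (forall i, (i <= n)%N -> v i = v' i) ->
  wealth d v n = wealth d v' n.
Proof.
elim: n => //= n IHn vv'; have vvn i : (i <= n)%N -> v i = v' i.
  by move=> ilen; apply: vv'; exact: leqW.
by rewrite IHn// (anchor_ext _ vvn) !vv'.
Qed.

(** * Mixing all meshes with summable weights *)

Definition weight (k : nat) : R := 2^-1 ^+ k.+1.

Definition mesh (k : nat) : R := k.+1%:R^-1.

(** The mesh number [k] is traded from time [k] on only, so that all sums are
    finite. *)
Definition hedge v n : R :=
  \sum_(k < n) weight k * (wealth (mesh k) v n - wealth (mesh k) v k).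

Definition stake v n : R :=
  \sum_(k < n.+1) weight k / anchor (mesh k) v n ^+ 2.

Lemma weight_gt0 k : 0 < weight k.
Proof. by rewrite exprn_gt0// invr_gt0. Qed.

Lemma mesh_gt0 k : 0 < mesh k.
Proof. by rewrite invr_gt0. Qed.

Lemma mesh_le1 k : mesh k <= 1.
Proof. by rewrite invf_le1// ler1n. Qed.

Lemma sum_weight_le m n : \sum_(m <= k < n) weight k <= 2^-1 ^+ m.
Proof.
have [mn|/ltnW nm] := leqP m n; last by rewrite big_geq// exprn_ge0.
under eq_bigr => k _.
  have -> : weight k = - 2^-1 ^+ k.+1 - (- 2^-1 ^+ k).
    by rewrite /weight exprS; field.
  over.
by rewrite telescope_sumr// opprK addrC gerDl oppr_le0 exprn_ge0.
Qed.

(** The gain is linear in the next value of [v], with a stake known at time [n]. Mesh [n] makes its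
    first trade here, hence the [n.+1] terms of [stake]. *)
Lemma hedgeS v n :
  hedge v n.+1 = hedge v n + stake v n * (v n.+1 - v n).
Proof.
rewrite /hedge /stake mulr_suml !big_ord_recr /= addrA -big_split /=.
congr (_ + _); first by apply: eq_bigr => k _; ring.
by ring.
Qed.

Lemma stake_ge0 v n : 0 <= stake v n.
Proof.
by apply: sumr_ge0 => k _; rewrite divr_ge0 ?sqr_ge0 ?ltW ?weight_gt0.
Qed.

Lemma hedge_ext v v' n : (forall i, (i <= n)%N -> v i = v' i) ->
  hedge v n = hedge v' n.
Proof.
move=> vv'; apply: eq_bigr => k _; rewrite (wealth_ext _ vv').
by rewrite (@wealth_ext _ v v' k)// => i ik; apply/vv'/(leq_trans ik)/ltnW.
Qed.

Lemma stake_ext v v' n : (forall i, (i <= n)%N -> v i = v' i) ->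
  stake v n = stake v' n.
Proof. by move=> vv'; apply: eq_bigr => k _; rewrite (anchor_ext _ vv'). Qed.

(** For [v >= 1], the gain of mesh [k] since time [k] splits into accumulated gaps, monotone, and a
    tangent term, bounded. *)
Definition level v k n := realized (mesh k) v n - realized (mesh k) v k.
Definition fluct v k n := tangent (anchor (mesh k) v n) (v n) -
  tangent (anchor (mesh k) v k) (v k).

Lemma hedgeE v n : hedge v n =
  \sum_(k < n) weight k * level v k n + \sum_(k < n) weight k * fluct v k n.
Proof.
rewrite -big_split; apply: eq_bigr => k _ /=.
by rewrite /level /fluct /realized; ring.
Qed.

(** Both tangent values lie in [[-1, 0]]; the upper bound uses [mesh k <= 1]. *)
Lemma fluct_bound v k n : (forall i, 1 <= v i) -> `|fluct v k n| <= 1.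
Proof.
move=> v1; have B i : - 1 <= tangent (anchor (mesh k) v i) (v i) <= 0.
  rewrite tangent_ge ?anchor_ge1//= tangent_le0 ?anchor_ge1//.
  exact/(lt_le_trans _ (mesh_le1 k))/anchor_close/mesh_gt0.
by rewrite /fluct ler_norml; move: (B n) (B k); lra.
Qed.

Lemma level_ge0 v k n : (forall i, 1 <= v i) -> (k <= n)%N -> 0 <= level v k n.
Proof. by move=> v1 kn; rewrite subr_ge0 realized_nondecreasing. Qed.

Lemma sum_fluct_ge v n : (forall i, 1 <= v i) ->
  - 1 <= \sum_(k < n) weight k * fluct v k n.
Proof.
move=> v1; rewrite -(opprK (\sum_(_ < _) _)) lerN2 -sumrN.
apply: le_trans (_ : \sum_(0 <= k < n) weight k <= _); last first.
  by rewrite (le_trans (sum_weight_le _ _))// expr0.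
rewrite big_mkord; apply: ler_sum => k _.
have := fluct_bound k n v1; have := weight_gt0 k; rewrite ler_norml.
by nra.
Qed.

Lemma hedge_ge v n : (forall i, 1 <= v i) -> - 1 <= hedge v n.
Proof.
move=> v1; rewrite hedgeE (le_trans (sum_fluct_ge n v1))// lerDr sumr_ge0//.
by move=> k _; rewrite mulr_ge0 ?(ltW (weight_gt0 _))// level_ge0// ltnW.
Qed.

(** * Behaviour of the hedge when [v] converges *)

(** Dominated convergence for series: the tail beyond [K] is at most [2^-1 ^+ K], uniformly in
    [n]. *)
Lemma tannery (g : nat -> nat -> R) :
  (forall k n, `|g k n| <= weight k) -> (forall k, cvgn (g k)) ->
  cvgn (fun n => \sum_(k < n) g k n).
Proof.
move=> gw gcvg; apply: cauchy_cvg; apply: cauchy_exP => e e0.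
have [K Ke] : exists K, 2^-1 ^+ K < e / 2 :> R.
  have : \forall n \near \oo, `|(2^-1 : R) ^+ n| < e / 2.
    by apply: cvgr0_norm_lt; [apply: cvg_expr; rewrite ger0_norm; lra | lra].
  case=> K _ /(_ K (leqnn _)); rewrite ger0_norm ?exprn_ge0// => ?.
  by exists K.
have Kcvg : cvgn (fun n => \sum_(k < K) g k n).
  elim: {Ke} K => [|K IHK].
    by under eq_fun do rewrite big_ord0; exact: is_cvg_cst.
  by under eq_fun do rewrite big_ord_recr /=; exact: is_cvgD.
exists (limn (fun n => \sum_(k < K) g k n)).
suff : \forall n \near \oo,
  `|limn (fun n => \sum_(k < K) g k n) - \sum_(k < n) g k n| < e by [].
near=> n.
have Kn : (K <= n)%N by near: n; exact: nbhs_infty_ge.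
rewrite -(big_mkord xpredT (fun k => g k n)) (big_cat_nat (n := K))//=.
rewrite big_mkord opprD addrA (splitr e) (le_lt_trans (ler_normB _ _))//.
rewrite ltrD//.
  by near: n; apply: cvgr_dist_lt; [exact: Kcvg | lra].
rewrite (le_lt_trans _ Ke)//; apply: le_trans (sum_weight_le K n).
by apply: le_trans (ler_norm_sum _ _ _) _; apply: ler_sum.
Unshelve. all: by end_near. Qed.

Lemma anchor_const d v m n : (m <= n)%N ->
  (forall i, (m <= i < n)%N -> `|v i.+1 - anchor d v i| < d) ->
  anchor d v n = anchor d v m.
Proof.
elim: n => [|n IHn]; first by rewrite leqn0 => /eqP->.
rewrite leq_eqVlt => /predU1P[->//|mn] vd /=.
rewrite leNgt vd ?leqnn ?andbT//=; apply: IHn => // i /andP[mi ilt].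
by apply: vd; rewrite mi ltnW.
Qed.

(** Once [v] varies by less than [d], at most one more update occurs, since the new anchor is itself
    a late value of [v]. *)
Lemma anchor_is_cvg d v : 0 < d -> cvgn v -> cvgn (anchor d v).
Proof.
move=> d0 vcvg.
have [N vN] : exists N, forall m n, (N <= m)%N -> (N <= n)%N ->
    `|v n - v m| < d.
  have : \forall n \near \oo, `|limn v - v n| < d / 2.
    by apply: cvgr_dist_lt; [exact: vcvg | lra].
  case=> N _ vN; exists N => m n /vN /= + /vN /=.
  by rewrite !ltr_norml => /andP[? ?] /andP[? ?]; apply/andP; split; lra.
have [[n [Nn dn]]|noreb] :=
    pselect (exists n, (N <= n)%N /\ d <= `|v n.+1 - anchor d v n|).
  apply/cvg_ex; exists (v n.+1); apply: cvg_near_cst.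
  exists n.+1 => //= m /=; elim: m => //= m IHm.
  rewrite ltnS leq_eqVlt => /predU1P[<-|nm] /=; first by rewrite dn.
  rewrite (IHm nm) leNgt vN ?(leq_trans Nn)// ltnW//.
  exact: (ltn_trans nm).
apply/cvg_ex; exists (anchor d v N); apply: cvg_near_cst.
exists N => //= n Nn; apply: anchor_const => // i /andP[Ni _].
by rewrite ltNge; apply/negP => di; apply: noreb; exists i.
Qed.

Lemma level_nondecreasing v : (forall i, 1 <= v i) ->
  nondecreasing_seq (fun n => \sum_(k < n) weight k * level v k n).
Proof.
move=> v1; apply/nondecreasing_seqP => n; rewrite big_ord_recr /=.
rewrite -[leLHS]addr0 lerD//.
  apply: ler_sum => k _; rewrite ler_pM2l ?weight_gt0// lerB//.
  exact: (realized_nondecreasing _ v1).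
by rewrite mulr_ge0 ?(ltW (weight_gt0 _))// level_ge0.
Qed.

Lemma sum_fluct_is_cvg v : (forall i, 1 <= v i) -> cvgn v ->
  cvgn (fun n => \sum_(k < n) weight k * fluct v k n).
Proof.
move=> v1 vcvg; apply: (@tannery (fun k n => weight k * fluct v k n)) => k.
  move=> n; rewrite normrM gtr0_norm ?weight_gt0//.
  by rewrite ler_piMr ?(ltW (weight_gt0 _))// fluct_bound.
have acvg := anchor_is_cvg (mesh_gt0 k) vcvg.
have alim0 : limn (anchor (mesh k) v) != 0.
  rewrite gt_eqF// (lt_le_trans ltr01)//; apply: limr_ge => //.
  by apply: nearW => n; exact: anchor_ge1.
have icvg : cvgn (fun n => (anchor (mesh k) v n)^-1) by exact: is_cvgV.
rewrite /fluct /tangent; under eq_fun do rewrite expr2 invfM.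
apply: is_cvgM; first exact: is_cvg_cst.
apply: is_cvgB; last exact: is_cvg_cst.
apply: is_cvgB; first by apply: is_cvgM => //; exact: is_cvgM.
by apply: is_cvgM => //; exact: is_cvg_cst.
Qed.

(** * Divergence of the hedge under persistent oscillation *)

(** When [v] is at most [B], the anchor is below [B + 1], and the next update, forced by
    oscillation, gains at least a fixed [c > 0]. *)
Lemma realized_dvg d v (B : R) : 0 < d <= 1 -> (forall i, 1 <= v i) ->
  (forall N, exists2 n, (N <= n)%N & d *+ 2 <= `|v n - v N|) ->
  (forall N, exists2 n, (N <= n)%N & v n <= B) ->
  forall A, exists n, A <= realized d v n.
Proof.
move=> /andP[d0 d1] v1 osc bnd A.
have B1 : 1 <= B by have [n _] := bnd 0%N; apply: le_trans.
pose c := d ^+ 2 / ((B + 1) ^+ 2 * (B + 1 + 1)).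
have c0 : 0 < c by rewrite divr_gt0 ?exprn_gt0// mulr_gt0 ?exprn_gt0//; lra.
have step N : exists n, realized d v N + c <= realized d v n.
  have [m Nm vm] := bnd N.
  have ex : exists i, (m <= i)%N && (d <= `|v i.+1 - anchor d v i|).
    (* Without an update, [v n] and [v m] are within [d] of the same anchor, against [osc]. *)
    apply: contrapT => noreb; have [n mn] := osc m.
    have H i : (m <= i)%N -> `|v i.+1 - anchor d v i| < d.
      move=> mi; rewrite ltNge; apply/negP => di.
      by apply: noreb; exists i; rewrite mi.
    apply/negP; rewrite -ltNge mulr2n.
    have an : anchor d v n = anchor d v m.
      by apply: anchor_const => // i /andP[/H].
    have := anchor_close v n d0; have := anchor_close v m d0; rewrite an.
    by rewrite !ltr_norml => /andP[? ?] /andP[? ?]; apply/andP; split; lra.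
  have [i /andP[mi di] imin] := ex_minnP ex.
  exists i.+1; rewrite realizedS// di; apply: lerD.
    by apply: realized_nondecreasing => //; exact: leq_trans mi.
  apply: tangent_gap_ge => //; rewrite ?d0// anchor_ge1//=.
  have -> : anchor d v i = anchor d v m.
    apply: anchor_const => // j /andP[mj ji]; rewrite ltNge; apply/negP => dj.
    by have := imin j; rewrite mj dj leqNgt ji => /(_ isT).
  by have := anchor_close v m d0; rewrite ltr_norml => /andP[? ?]; lra.
have many j : exists n, realized d v 0 + c *+ j <= realized d v n.
  elim: j => [|j [n jn]]; first by exists 0%N; rewrite addr0.
  have [m nm] := step n; exists m; apply: le_trans nm.
  by rewrite mulrSr addrA lerD2r.
have [n jn] := many (Num.truncn ((A - realized d v 0) / c)).+1.
exists n; apply: le_trans jn; rewrite -lerBlDl -mulr_natr mulrC.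
by rewrite -ler_pdivrMr// ltW// truncnS_gt.
Qed.

Lemma not_cvgn_osc v : ~ cvgn v ->
  exists2 d : R, 0 < d & forall N, exists2 n, (N <= n)%N & d <= `|v n - v N|.
Proof.
move=> vncvg; apply: contrapT => nosc; apply: vncvg.
apply: cauchy_cvg; apply: cauchy_exP => e e0.
apply: contrapT => far; apply: nosc; exists e => // N.
apply: contrapT => near; apply: far; exists (v N), N => //= n Nn.
by rewrite /ball /= distrC ltNge; apply/negP => en; apply: near; exists n.
Qed.

Lemma hedge_dvg v (B : R) : (forall i, 1 <= v i) -> ~ cvgn v ->
  (forall N, exists2 n, (N <= n)%N & v n <= B) -> hedge v @ \oo --> +oo.
Proof.
move=> v1 /not_cvgn_osc[d d0 osc] bnd.
have [k kd] : exists k, mesh k *+ 2 <= d.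
  exists (Num.truncn (2 / d)); rewrite /mesh -[leLHS]mulr_natl ler_pdivrMr//.
  by rewrite mulrC -ler_pdivrMr// ltW// truncnS_gt.
apply/cvgryPge => A.
(* Mesh [k] alone is to contribute [A + 1]: the spare 1 absorbs the fluctuations, and the other
   levels are nonnegative. *)
have [||n An] := @realized_dvg (mesh k) v B _ v1 _ bnd
    ((A + 1) / weight k + realized (mesh k) v k).
- by rewrite mesh_gt0 mesh_le1.
- by move=> N; have [n Nn dn] := osc N; exists n => //; exact: le_trans dn.
near=> m; have nm : (n <= m)%N by near: m; exact: nbhs_infty_ge.
have km : (k < m)%N by near: m; exact: nbhs_infty_gt.
rewrite hedgeE -[leLHS](addrK 1) lerD ?sum_fluct_ge//.
apply: (@le_trans _ _ (weight k * level v k m)).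
  rewrite mulrC -ler_pdivrMr ?weight_gt0// lerBrDr (le_trans An)//.
  exact: realized_nondecreasing.
rewrite (bigD1 (Ordinal km))//= lerDl sumr_ge0// => i _.
by rewrite mulr_ge0 ?(ltW (weight_gt0 _))// level_ge0// ltnW.
Unshelve. all: by end_near. Qed.

Lemma hedged_is_cvg v (e b : R) : 0 < e -> (forall i, 1 <= v i) ->
  cvgn (fun n => (v n + e * (1 + hedge v n) + b)%:E).
Proof.
move=> e0 v1; have [vcvg|vncvg] := pselect (cvgn v).
  (* [u] is nondecreasing, with limit possibly +oo; [y] has a finite limit, so the limits can be
     added. *)
  pose u n := e * \sum_(k < n) weight k * level v k n.
  pose y n := v n + e * (1 + \sum_(k < n) weight k * fluct v k n) + b.
  have -> : (fun n => (v n + e * (1 + hedge v n) + b)%:E) =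
      (fun n => (u n)%:E + (y n)%:E)%E.
    by apply/funext => n; rewrite -EFinD hedgeE /u /y; congr EFin; ring.
  have ycvg : cvgn y.
    apply: is_cvgD; last exact: is_cvg_cst.
    apply: is_cvgD => //; apply: is_cvgM; first exact: is_cvg_cst.
    by apply: is_cvgD; [exact: is_cvg_cst | exact: sum_fluct_is_cvg].
  apply/cvg_ex; eexists; apply: cvgeD; last first.
  - by apply: cvg_EFin; [exact: nearW | exact: ycvg].
  - apply: ereal_nondecreasing_cvgn => m n mn.
    by rewrite lee_fin ler_pM2l//; exact: level_nondecreasing.
  - exact: fin_num_adde_defl.
(* Either [v] keeps returning below some [B] and the hedge tends to +oo, or [v] itself does while
   the hedge stays above -1. *)
have [[B bnd]|nobnd] :=
    pselect (exists B, forall N, exists2 n, (N <= n)%N & v n <= B).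
  have /cvgryPge hdvg := hedge_dvg v1 vncvg bnd.
  apply/cvg_ex; exists +oo%E; apply/cvgeyPge => A.
  near=> n; rewrite lee_fin.
  have : (A - b) / e <= hedge v n by near: n; exact: hdvg.
  rewrite ler_pdivrMr// mulrC => An.
  by rewrite mulrDr mulr1; move: (v1 n); lra.
apply/cvg_ex; exists +oo%E; apply/cvgeyPge => A.
have [N AN] : exists N, forall n, (N <= n)%N -> A - b < v n.
  apply: contrapT => noN; apply: nobnd; exists (A - b) => N.
  apply: contrapT => noNn; apply: noN; exists N => n Nn; rewrite ltNge.
  by apply/negP => vn; apply: noNn; exists n.
exists N => //= n /AN vn; rewrite lee_fin.
have : 0 <= e * (1 + hedge v n).
  by rewrite mulr_ge0 ?(ltW e0)//; have := hedge_ge n v1; lra.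
by move: vn; lra.
Unshelve. all: by end_near. Qed.

End Rebalancing.

Local Open Scope ereal_scope.

(** * Affine maps under upper expectations; lower limits *)

Lemma dual_addeEFin (R : realType) (x : \bar R) (r : R) :
  dual_adde x r%:E = x + r%:E.
Proof. by case: x. Qed.

(** Since [b] is finite, [dual_adde] agrees here with the default addition. *)
Lemma UE_affine (R : realType) (X : finType) (P : (X -> \bar R) -> \bar R)
    (g : X -> \bar R) (a b : R) : upper_expectation P -> bounded_below g ->
  (0 < a)%R -> P (fun x => a%:E * g x + b%:E) <= a%:E * P g + b%:E.
Proof.
move=> hP gb a0; rewrite -[leRHS]dual_addeEFin -(UE_homogeneous hP a0 gb).
rewrite -{2}(UE_cst hP b).
under eq_fun do rewrite -dual_addeEFin.
apply: UE_subadditive => //; last by exists b.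
have [c cg] := gb; exists (a * c)%R => y.
by rewrite EFinM lee_pmul2l// lte_fin.
Qed.

Lemma le_limn_einf (R : realType) (u v : nat -> \bar R) :
  (forall n, u n <= v n) -> limn_einf u <= limn_einf v.
Proof.
move=> uv; rewrite !limn_einf_lim; apply: lee_lim; try exact: is_cvg_einfs.
apply: nearW => n; apply: le_ereal_inf_tmp => _ [k nk <-].
by apply: ge_ereal_inf; exists (u k) => //; exists k.
Qed.

Lemma take_path_take (X : Type) (w : nat -> X) m n : (m <= n)%N ->
  take m (path_take w n) = path_take w m.
Proof.
by move=> mn; rewrite /path_take /mkseq -map_take take_iota (minn_idPl mn).
Qed.

(** * The hedged supermartingale and its limits along paths *)

Section HedgedSupermartingale.
Variables (R : realType) (X : finType) (Q : seq X -> (X -> \bar R) -> \bar R).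
Hypothesis hQ : imprecise_tree Q.
Variables (M : seq X -> \bar R) (s : seq X) (c e : R).
Hypothesis M_super : supermartingale Q M.
Hypothesis M_ge : forall t, c%:E <= M t.
Hypothesis c_le0 : (c <= 0)%R.
Hypothesis e_gt0 : (0 < e)%R.

(** A value +oo of [M] is made absorbing, as [M] may come back from +oo to
    finite values; [take i t = t] when [size t <= i]. *)
Definition alive (t : seq X) : Prop :=
  prefix s t /\ forall i, (size s <= i)%N -> M (take i t) < +oo.

(** At +oo, where [fine] is 0, [c <= 0] still gives [track t n >= 1]. *)
Definition track (t : seq X) (n : nat) : R :=
  fine (M (take (size s + n) t)) - c + 1.

(** The value +oo at situations that do not extend [s] is harmless, since only
    the value at [s] and the paths through [s] matter. *)
Definition hedged (t : seq X) : \bar R :=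
  if `[< alive t >] then
    let n := (size t - size s)%N in
    (track t n + e * (1 + hedge (track t) n) + (c - 1))%:E
  else +oo.

Lemma fine_M_ge t : (c <= fine (M t))%R.
Proof. by have := M_ge t; case: (M t). Qed.

Lemma track_ge1 t n : (1 <= track t n)%R.
Proof. by rewrite /track; have := fine_M_ge (take (size s + n) t); lra. Qed.

Lemma alive_size t : alive t -> (size s <= size t)%N.
Proof. by case=> /size_prefix. Qed.

Lemma alive_fineK t : alive t -> M t = (fine (M t))%:E.
Proof.
move=> t_alive; rewrite fineK// fin_numE; have [_] := t_alive.
move=> /(_ _ (alive_size t_alive)); rewrite take_size lt_neqAle => /andP[-> _].
by rewrite andbT -ltNye (lt_le_trans _ (M_ge t))// ltNyr.
Qed.

Lemma track_size t : (size s <= size t)%N ->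
  track t (size t - size s) = (fine (M t) - c + 1)%R.
Proof. by move=> st; rewrite /track subnKC// take_size. Qed.

Lemma hedgedE t : alive t -> hedged t =
  (fine (M t) + e * (1 + hedge (track t) (size t - size s)))%:E.
Proof.
move=> ta; rewrite /hedged asboolT// track_size ?alive_size//.
by congr EFin; ring.
Qed.

Lemma le_hedged t : M t <= hedged t.
Proof.
have [ta|ta] := pselect (alive t); last by rewrite /hedged asboolF// leey.
rewrite hedgedE// {1}alive_fineK// lee_fin lerDl mulr_ge0 ?(ltW e_gt0)//.
by have := hedge_ge (size t - size s) (track_ge1 t); lra.
Qed.

Lemma alive_rcons t x : alive t -> M (rcons t x) < +oo -> alive (rcons t x).
Proof.
move=> [st Mt] Mtx; split; first exact: prefix_trans (prefix_rcons _ _).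
move=> i si; have [it|it] := leqP i (size t).
  by rewrite -cats1 takel_cat// Mt.
by rewrite take_oversize// size_rcons.
Qed.

(** This affine form in the next value of [M] is what [UE_affine] needs; [a > 0] makes both sides
    +oo when [M] jumps to +oo. *)
Lemma hedged_rcons t x : alive t ->
  let a := (1 + e * stake (track t) (size t - size s))%R in
  hedged (rcons t x) = a%:E * M (rcons t x) +
    (fine (M t) + e * (1 + hedge (track t) (size t - size s))
     - a * fine (M t))%:E.
Proof.
move=> ta a; have st := alive_size ta.
have a0 : (0 < a)%R.
  by rewrite ltr_pwDl// mulr_ge0 ?(ltW e_gt0)// stake_ge0.
have [Mtx|] := ltP (M (rcons t x)) +oo; last first.
  rewrite leye_eq => /eqP Mtx; rewrite Mtx gt0_muley ?lte_fin// addye//.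
  rewrite /hedged asboolF// => -[_ /(_ (size (rcons t x)))].
  by rewrite take_size Mtx ltxx size_rcons => /(_ (leqW st)).
have txa := alive_rcons ta Mtx.
rewrite hedgedE// (alive_fineK txa) -EFinM -EFinD size_rcons subSn//.
have tr i : (i <= size t - size s)%N -> track (rcons t x) i = track t i.
  move=> it; rewrite /track -cats1 takel_cat//.
  by rewrite -(subnKC st) leq_add2l.
rewrite hedgeS (hedge_ext tr) (stake_ext tr) (tr _ (leqnn _)).
rewrite track_size//.
have := track_size (alive_size txa); rewrite size_rcons subSn// => ->.
by congr EFin; rewrite /a; ring.
Qed.

Lemma hedged_supermartingale : supermartingale Q hedged.
Proof.
move=> t; have [ta|ta] := pselect (alive t); last first.
  by rewrite {2}/hedged asboolF// leey.
under eq_fun do rewrite hedged_rcons//.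
apply: le_trans (UE_affine _ (hQ t) _ _) _.
- by exists c.
- by rewrite ltr_pwDl// mulr_ge0 ?(ltW e_gt0)// stake_ge0.
set a := (1 + _)%R.
have a0 : (0 <= a)%R by rewrite addr_ge0// mulr_ge0 ?(ltW e_gt0)// stake_ge0.
rewrite hedgedE//; apply: le_trans (leeD2r _ _) _.
  by apply: lee_wpmul2l; [rewrite lee_fin | exact: M_super].
by rewrite (alive_fineK ta) -EFinM -EFinD lee_fin /= addrC subrK.
Qed.

Lemma hedged_bb : bb_supermartingale Q hedged.
Proof.
split; first exact: hedged_supermartingale.
by exists c => t; exact: le_trans (le_hedged t).
Qed.

Lemma hedged_start : M s < +oo -> hedged s = M s + e%:E.
Proof.
move=> Ms; have sa : alive s.
  by split=> [|i si]; [exact: prefix_refl | rewrite take_oversize].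
by rewrite hedgedE// subnn /hedge big_ord0 addr0 mulr1 EFinD -alive_fineK.
Qed.

(** If [M] stays finite from [s] on, a time shift by [size s] reduces to [hedged_is_cvg]; otherwise
    the path ends up constantly at +oo. *)
Lemma hedged_path_is_cvg w : cylinder s w ->
  cvgn (fun n => hedged (path_take w n)).
Proof.
move=> sw; have [fin|inf] :=
    pselect (forall n, (size s <= n)%N -> M (path_take w n) < +oo).
  pose v n := (fine (M (path_take w (size s + n))) - c + 1)%R.
  have v1 n : (1 <= v n)%R.
    by rewrite /v; have := fine_M_ge (path_take w (size s + n)); lra.
  suff : cvgn [sequence hedged (path_take w (n + size s))]_n.
    move=> /cvg_ex[l wl]; apply/cvg_ex; exists l.
    by rewrite -(cvg_shiftn (size s)); exact: wl.
  rewrite (_ : [sequence _]_n =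
      fun n => (v n + e * (1 + hedge v n) + (c - 1))%:E).
    exact: hedged_is_cvg.
  apply/funext => n /=; rewrite /hedged asboolT; last first.
    split.
      by rewrite prefixE take_path_take ?leq_addl//; apply/eqP.
    move=> i si; have [iw|/ltnW iw] := leqP i (n + size s).
      by rewrite take_path_take//; exact: fin.
    by rewrite take_oversize ?size_mkseq//; apply: fin; exact: leq_addl.
  rewrite size_mkseq addnK /=.
  have vt i : (i <= n)%N -> track (path_take w (n + size s)) i = v i.
    by move=> ilen; rewrite /track take_path_take// addnC leq_add2r.
  by rewrite vt// (hedge_ext vt).
have [N [sN /negP]] : exists N, (size s <= N)%N /\ ~ M (path_take w N) < +oo.
  apply: contrapT => noN; apply: inf => n sn.
  by apply: contrapT => Mn; apply: noN; exists n.
rewrite -leNgt leye_eq => /eqP MN.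
apply/cvg_ex; exists +oo; apply: cvg_near_cst.
exists N => //= n /= Nn; rewrite /hedged asboolF// => -[_ /(_ N sN)].
by rewrite take_path_take// MN ltxx.
Qed.

End HedgedSupermartingale.

Theorem proposition20 (R : realType) (X : finType) (hX : (0 < #|X|)%N)
    (Q : seq X -> (X -> \bar R) -> \bar R) (hQ : imprecise_tree Q)
    (f : (nat -> X) -> \bar R) (s : seq X) :
  upper_EV Q f s =
  ereal_inf [set M s | M in [set M | bb_supermartingale Q M /\
                                     lim_ge_on s M f]].
Proof.
apply/eqP; rewrite eq_le; apply/andP; split.
  (* An existing limit equals the lower limit, so every competitor on the right is one on the
     left. *)
  apply: ereal_inf_le_tmp => _ [M [Mbb Mf] <-]; exists M => //; split=> // w sw.
  by have [wcvg] := Mf w sw; rewrite is_cvg_limn_einfE.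
apply: le_ereal_inf_tmp => _ [M [[Msuper [c0 Mc0]] Mf] <-].
have [Ms|] := ltP (M s) +oo; last by rewrite leye_eq => /eqP->; rewrite leey.
apply/lee_addgt0Pr => e e0.
(* A nonpositive bound keeps [track] at least 1 even where [M] is +oo. *)
pose c := Num.min c0 0%R.
have Mc t : c%:E <= M t.
  by apply: le_trans (Mc0 t); rewrite lee_fin ge_min lexx.
have c0' : (c <= 0)%R by rewrite ge_min lexx orbT.
rewrite -(hedged_start e Mc Ms); apply: ereal_inf_lbound.
exists (hedged M s c e) => //; split; first exact: hedged_bb.
move=> w sw; have wcvg := hedged_path_is_cvg Mc c0' e0 sw; split=> //.
rewrite -(is_cvg_limn_einfE wcvg); apply: le_trans (Mf w sw) _.
by apply: le_limn_einf => n; exact: le_hedged.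
Qed.
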